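(* There exist finite simple graphs $G$ and $H$ such that $\pi^{c}(G\,\Box\,H)>\pi^{c}(G)\,\pi^{c}(H)$.
   Context: The Cartesian product $G\,\Box\,H$ has vertex set $V(G)\times V(H)$, with $(u,v)$ adjacent to $(w,x)$ iff either $uw\in E(G)$ and $v=x$, or $u=w$ and $vx\in E(H)$. A configuration of cops on a graph is a function $C$ from its vertices to $\mathbb{Z}_{\ge 0}$ of size $\sum_v C(v)$. A pebbling step from a vertex $u$ with at least two cops to an adjacent vertex $v$ removes two cops from $u$ and adds one cop to $v$. In the cops and robbers pebbling game, cops are placed according to $C$, then a robber chooses a starting vertex; thereafter, in each turn the cops make pebbling steps, after which the robber either moves to an adjacent vertex or stays put. The robber is captured when he occupies a vertex holding at least one cop. The cop pebbling number $\pi^{c}(G)$ is the minimum $m$ such that some configuration of size $m$ allows the cops to capture the robber regardless of how he starts and moves. *)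

(* Defs.v *)
From mathcomp Require Import all_boot.
From mathcomp Require Import boolp.

Set Implicit Arguments.
Unset Strict Implicit.
Unset Printing Implicit Defensive.

Record sgraph := SGraph {
  vertex :> finType;
  edge : rel vertex;
  edge_sym : symmetric edge;
  edge_irrefl : irreflexive edge }.

Section CartesianProduct.
Variables G H : sgraph.

Definition cart_edge : rel (G * H) := fun p q =>
  (edge p.1 q.1 && (p.2 == q.2)) || ((p.1 == q.1) && edge p.2 q.2).

Lemma cart_edge_sym : symmetric cart_edge.
Proof.
move=> p q; rewrite /cart_edge.
by rewrite (edge_sym p.1) (edge_sym p.2) (eq_sym p.1) (eq_sym p.2).
Qed.

Lemma cart_edge_irrefl : irreflexive cart_edge.
Proof. by move=> p; rewrite /cart_edge !edge_irrefl andbF. Qed.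

Definition cart_prod : sgraph := SGraph cart_edge_sym cart_edge_irrefl.

End CartesianProduct.

Section CopPebbling.
Variable G : sgraph.

Definition config := {ffun G -> nat}.

Definition config_size (C : config) : nat := \sum_(v : G) C v.

(* A turn of the cops is a finite, possibly empty, list of pebbling steps,
   the pair (u, v) being a step from u to v. As in the classical game, a cop
   moves along at most one edge per turn: the two cops used by a step must have
   been on its tail at the start of the turn, so steps may share a tail but
   cannot be chained. If chaining were allowed, the robber would either be
   caught on the first turn or be safe where he stands forever, and the game
   would reduce to optimal pebbling. *)
Definition legal_turn (C : config) (s : seq (G * G)) : bool :=
  all (fun e => edge e.1 e.2) s &&
  [forall u : G, 2 * count (fun e => e.1 == u) s <= C u].

Definition after_turn (C : config) (s : seq (G * G)) : config :=
  [ffun u => C u - 2 * count (fun e => e.1 == u) s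
             + count (fun e => e.2 == u) s].

(* [cops_win C r]: with the cops at C, the robber at r and the cops to play,
   the cops can force a capture after finitely many turns. *)
Inductive cops_win : config -> G -> Prop :=
| Captured (C : config) (r : G) : 0 < C r -> cops_win C r
| Capture (C : config) (r : G) (s : seq (G * G)) :
    legal_turn C s -> 0 < after_turn C s r -> cops_win C r
| Continue (C : config) (r : G) (s : seq (G * G)) :
    legal_turn C s ->
    (forall r', (r' == r) || edge r r' -> cops_win (after_turn C s) r') ->
    cops_win C r.

Definition winning_size (m : nat) : Prop :=
  exists C : config, config_size C = m /\ forall r : G, cops_win C r.

Lemma winning_size_ex : exists m, `[< winning_size m >].
Proof.
exists (config_size [ffun=> 1]); apply/asboolP; exists [ffun=> 1]; split=> // r.
by apply: Captured; rewrite ffunE.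
Qed.

Definition cop_pebbling_number : nat := ex_minn winning_size_ex.

End CopPebbling.

(* Main.v *)
(** Two cops on one vertex of a complete graph catch the robber at once, so
    both factors K_5 cost at most 2, and it suffices that four cops lose on the
    rook's graph K_5 [] K_5. The robber stays on free vertices without a
    neighbour holding two cops. Four cops do not prevent him from starting
    there. He need only react once cops have stepped, when at most three are
    left and just one vertex v can hold two of them; he then escapes along the
    line through his vertex that avoids v. *)
Require Import Defs.
From mathcomp Require Import all_boot.
From mathcomp Require Import boolp zify.

Set Implicit Arguments.
Unset Strict Implicit.
Unset Printing Implicit Defensive.

Section RobberStrategy.
Variable G : sgraph.
Implicit Types (C : config G) (r : G) (s : seq (G * G)).

(** The robber's invariant when the cops are to play: no legal turn can put a cop on [r]. *)
Definition safe C r : Prop := C r = 0 /\ forall v, edge v r -> C v < 2.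

Lemma sum_count (f : G * G -> G) s :
  \sum_u count (fun e => f e == u) s = size s.
Proof.
elim: s => [|e s IHs] /=; first by rewrite big1.
rewrite big_split /= IHs (bigD1 (f e)) //= eqxx big1 // => u.
by rewrite eq_sym => /negPf ->.
Qed.

Lemma size_after_turn C s :
  legal_turn C s -> config_size (after_turn C s) + size s = config_size C.
Proof.
case/andP=> _ /forallP legal; rewrite /config_size.
rewrite (eq_bigr _ (fun u _ => ffunE _ u)) big_split /= sum_count.
(* The [size s] cops arriving at heads and the added [size s] make up the 2 [size s] cops taken from
   tails. Legality then makes the truncated subtraction exact. *)
rewrite -addnA addnn -mul2n -(sum_count fst s) big_distrr -big_split /=.
by apply: eq_bigr => u _; rewrite subnK.
Qed.

(** A step ending at [r] would need two cops on a neighbour of [r]. *)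
Lemma safe_after_turn C s r :
  legal_turn C s -> safe C r -> after_turn C s r = 0.
Proof.
case/andP=> /allP s_edge /forallP legal [Cr0 r_safe].
rewrite ffunE Cr0 sub0n add0n; apply/eqP; rewrite -leqn0 leqNgt -has_count.
apply/hasP => -[e es /eqP er].
have := r_safe e.1; rewrite -er (s_edge _ es) => /(_ isT).
have: 0 < count (fun e' => e'.1 == e.1) s.
  by rewrite -has_count; apply/hasP; exists e.
by have := legal e.1; lia.
Qed.

(** Induction on the cops' strategy. After an empty turn the position is unchanged and the robber
    waits; any other turn costs a cop, so an escape is needed only from configurations smaller than
    [m]. *)
Lemma robber_escapes m C r :
  (forall C' r0, config_size C' < m -> C' r0 = 0 ->
     exists r', ((r' == r0) || edge r0 r') /\ safe C' r') ->
  config_size C <= m -> safe C r -> ~ cops_win C r.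
Proof.
move=> escape size_C safe_r win; elim: win size_C safe_r => {C r}.
- by move=> C r Cr _ [Cr0 _]; rewrite Cr0 in Cr.
- by move=> C r s legal caught _ /(safe_after_turn legal) C'r; rewrite C'r in caught.
move=> C r s legal _ IH size_C safe_r.
have size_C' := size_after_turn legal.
have [s0 | s_gt0] := posnP (size s).
  apply: (IH r); rewrite ?eqxx //; first by lia.
  suff -> : after_turn C s = C by [].
  by apply/ffunP => u; rewrite ffunE (size0nil s0) /= muln0 subn0 addn0.
have [||r' [r_r' safe_r']] := escape (after_turn C s) r.
- by lia.
- exact: safe_after_turn.
by apply: IH r_r' _ safe_r'; lia.
Qed.

End RobberStrategy.

Definition neq_rel (n : nat) : rel 'I_n := fun x y => x != y.

Lemma neq_rel_sym n : symmetric (@neq_rel n).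
Proof. by move=> x y; rewrite /neq_rel eq_sym. Qed.

Lemma neq_rel_irrefl n : irreflexive (@neq_rel n).
Proof. by move=> x; rewrite /neq_rel eqxx. Qed.

Definition complete_graph (n : nat) : sgraph :=
  SGraph (@neq_rel_sym n) (@neq_rel_irrefl n).

Lemma cop_pebbling_number_le (G : sgraph) m :
  winning_size G m -> cop_pebbling_number G <= m.
Proof.
by rewrite /cop_pebbling_number; case: ex_minnP => k _ kmin /asboolP /kmin.
Qed.

Lemma cop_pebbling_number_complete n :
  cop_pebbling_number (complete_graph n.+1) <= 2.
Proof.
apply: cop_pebbling_number_le.
exists [ffun v => if v == ord0 then 2 else 0]; split.
  rewrite /config_size (bigD1 ord0) //= ffunE eqxx big1 // => v /negPf v0.
  by rewrite ffunE v0.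
move=> r; have [->|r0] := eqVneq r ord0.
  by apply: Captured; rewrite ffunE eqxx.
apply: (@Capture (complete_graph n.+1) _ _ [:: (ord0, r)]); last first.
  by rewrite ffunE /= eqxx addn1.
rewrite /legal_turn /= andbT /neq_rel eq_sym r0 /=.
by apply/forallP => u; rewrite ffunE addn0 eq_sym; case: (u == ord0).
Qed.

(** The robber sits at ([i0], [j0]), threatened along row [i0] from column [j1], and looks for a
    cell of column [j0] to flee to. The threat takes two of at most three units, so column [j0]
    carries at most one and an empty row suffices. If no row were empty, row [i0] would carry two
    and the at least two other rows one each, four in all. *)
Lemma light_line_exists n (f : 'I_n -> 'I_n -> nat) (i0 j0 j1 : 'I_n) :
  2 < n -> j1 != j0 -> 1 < f i0 j1 -> \sum_i \sum_j f i j < 4 ->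
  exists k, \sum_j f k j + \sum_i f i j0 < 2.
Proof.
move=> n_gt2 j10 f_gt1 f_lt4.
have col_lt2 : \sum_i f i j0 < 2.
  suff: \sum_i f i j0 + f i0 j1 <= \sum_i \sum_j f i j by lia.
  rewrite [X in _ <= X]exchange_big /= [X in _ <= X](bigD1 j0) //= leq_add2l.
  rewrite (bigD1 j1) //= (bigD1 i0) //= -addnA; exact: leq_addr.
have [k /eqP row0 | rows_gt0] := pickP (fun k => \sum_j f k j == 0).
  by exists k; rewrite row0.
have rows_sum : n.-1 = \sum_(i | i != i0) 1.
  by rewrite sum1_card (cardC1 i0) card_ord.
have: n.-1 <= \sum_(i | i != i0) \sum_j f i j.
  by rewrite rows_sum; apply: leq_sum => i _; rewrite lt0n rows_gt0.
have: f i0 j1 <= \sum_j f i0 j by rewrite (bigD1 j1) //= leq_addr.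
by move: f_lt4; rewrite (bigD1 i0) //=; lia.
Qed.

Section RookGraph.
Variable n : nat.
Local Notation K := (complete_graph n).
Implicit Type C : config (cart_prod K K).

Definition row_sum C (i : 'I_n) : nat := \sum_j C (i, j).
Definition col_sum C (j : 'I_n) : nat := \sum_i C (i, j).

Lemma config_size_rows C : config_size C = \sum_i row_sum C i.
Proof.
by rewrite /config_size /row_sum pair_big; apply: eq_bigr => -[].
Qed.

Lemma config_size_cols C : config_size C = \sum_j col_sum C j.
Proof. by rewrite config_size_rows /row_sum exchange_big. Qed.

Lemma light_lines_safe C i j :
  row_sum C i + col_sum C j < 2 -> safe C (i, j).
Proof.
move=> light.
have row_ge k : C (i, k) <= row_sum C i.
  by rewrite /row_sum (bigD1 k) //= leq_addr.
have col_ge k : C (k, j) <= col_sum C j.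
  by rewrite /col_sum (bigD1 k) //= leq_addr.
split.
  (* The cell lies on both lines, so twice its value is below 2. *)
  apply/eqP; rewrite -leqn0 -ltnS -ltn_double -!addnn.
  exact: leq_ltn_trans (leq_add (row_ge j) (col_ge i)) light.
move=> [k l] /orP[] /= /andP[] => [_ /eqP -> | /eqP -> _].
  exact: leq_ltn_trans (leq_trans (col_ge k) (leq_addl _ _)) light.
exact: leq_ltn_trans (leq_trans (row_ge l) (leq_addr _ _)) light.
Qed.

Lemma rook_escape C (r0 : cart_prod K K) :
  2 < n -> config_size C < 4 -> C r0 = 0 ->
  exists r, ((r == r0) || edge r0 r) /\ safe C r.
Proof.
case: r0 => i0 j0 n_gt2 size_C Cr0.
have [[v [r_v Cv]] | no_threat] :=
  pselect (exists v, edge v ((i0, j0) : cart_prod K K) /\ 1 < C v); last first.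
  exists (i0, j0); rewrite eqxx; split=> //; split=> // v r_v.
  by rewrite ltnNge; apply/negP => Cv; apply: no_threat; exists v.
case: v r_v Cv => i1 j1 /orP[] /= /andP[] => [i10 /eqP -> Cv | /eqP -> j10 Cv].
  (* The threat is in the robber's column, so he flees along his row: the matrix is transposed. *)
  have [k light] : exists k, col_sum C k + row_sum C i0 < 2.
    apply: (@light_line_exists n (fun j i => C (i, j)) j0 i0 i1) => //.
    by rewrite -/(\sum_j col_sum C j) -config_size_cols.
  exists (i0, k); split; last by apply: light_lines_safe; rewrite addnC.
  rewrite /= /cart_edge /= /neq_rel xpair_eqE eqxx /= (eq_sym j0).
  by case: (k == j0); rewrite ?orbT.
have [k light] : exists k, row_sum C k + col_sum C j0 < 2.
  apply: (@light_line_exists n (fun i j => C (i, j)) i0 j0 j1) => //.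
  by rewrite -/(\sum_i row_sum C i) -config_size_rows.
exists (k, j0); split; last exact: light_lines_safe.
rewrite /= /cart_edge /= /neq_rel xpair_eqE eqxx /= (eq_sym i0).
by case: (k == i0).
Qed.

(* If every vertex had two cops on its row and column together, summing over
   the n^2 vertices would give 2 n^2 <= 2 n |C| <= 8 n. *)
Lemma rook_start C :
  4 < n -> config_size C <= 4 -> exists r, safe C r.
Proof.
move=> n_gt4 size_C.
have [[[i j] light] | heavy] :=
  pselect (exists p : 'I_n * 'I_n, row_sum C p.1 + col_sum C p.2 < 2).
  by exists (i, j); apply: light_lines_safe.
have: \sum_(i < n) \sum_(j < n) 2
      <= \sum_(i < n) \sum_(j < n) (row_sum C i + col_sum C j).
  apply: leq_sum => i _; apply: leq_sum => j _; rewrite leqNgt.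
  by apply/negP => light; apply: heavy; exists (i, j).
under [X in _ <= X]eq_bigr => i _ do
  rewrite big_split /= sum_nat_const -config_size_cols card_ord.
rewrite big_split /= -big_distrr /= -config_size_rows !sum_nat_const card_ord.
by nia.
Qed.

Lemma rook_four_cops_lose C :
  4 < n -> config_size C <= 4 -> exists r, ~ cops_win C r.
Proof.
move=> n_gt4 size_C; have [r safe_r] := rook_start n_gt4 size_C.
exists r; apply: (robber_escapes _ size_C safe_r) => C' r0 size_C' C'r0.
by apply: rook_escape; rewrite // (ltn_trans _ n_gt4).
Qed.

End RookGraph.

Theorem theorem15 :
  exists G H : sgraph,
    cop_pebbling_number G * cop_pebbling_number H
      < cop_pebbling_number (cart_prod G H).
Proof.
(* Five is the least order at which the count 2 n^2 <= 8 n in [rook_start] fails. *)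
exists (complete_graph 5), (complete_graph 5).
apply: (@leq_ltn_trans (2 * 2)).
  by apply: leq_mul; apply: cop_pebbling_number_complete.
rewrite {1}/cop_pebbling_number; case: ex_minnP => m /asboolP [C [<- win]] _.
rewrite ltnNge; apply/negP => size_C.
by have [//|r []] := rook_four_cops_lose _ size_C.
Qed.
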